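(* Let $W=(W_t)_{t\ge 0}$ be an $n$-dimensional standard Brownian motion and let $f=(f_1,\dots,f_m):\mathbb{R}^n\to\mathbb{R}^m$ be a measurable function such that the process $f(W_t)=(f_1(W_t),\dots,f_m(W_t))$, $t\ge 0$, is a martingale satisfying the following condition: for each $j=1,\dots,m$ there is a constant $C_j\in\mathbb{R}$ such that the process $\langle f_j(W)\rangle_t-C_j t$, $t\ge 0$, is non-increasing. Then $f$ coincides with an affine function for almost all $x$ in the sense of Lebesgue measure on $\mathbb{R}^n$, i.e. there are an $m\times n$ real matrix $A$ and a vector $B\in\mathbb{R}^m$ such that $f(x)=Ax+B$ for Lebesgue-almost every $x\in\mathbb{R}^n$.
   Context: $W$ is defined on a probability space $(\Omega,\mathcal{F},P)$ and starts at $0$; martingales are taken with respect to the filtration $F^W=(\mathcal{F}^W_t)_{t\ge0}$ generated by $W$ (completed by $P$-null sets). An $\mathbb{R}^m$-valued process is a martingale if each component is a martingale; no path regularity of the martingale is assumed. Every $F^W$-martingale $M$ has a continuous modification $\tilde M$, which is a locally square integrable martingale, and the square characteristic of $M$ is defined by $\langle M\rangle:=\langle\tilde M\rangle$, the predictable quadratic variation of $\tilde M$. Monotonicity of a process in $t$ is understood for almost all paths. *)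

(* Defs.v *)
From HB Require Import structures.
From mathcomp Require Import all_boot all_order all_algebra.
From mathcomp Require Import all_classical all_reals all_analysis.

Set Implicit Arguments.
Unset Strict Implicit.
Unset Printing Implicit Defensive.

Import Order.TTheory GRing.Theory Num.Theory.
Import numFieldNormedType.Exports.

Local Open Scope classical_set_scope.
Local Open Scope ring_scope.

(* Points of R^n are n-tuples: n.-tuple R carries the product of the Borel
   sigma-algebras, that is, the Borel sigma-algebra of R^n. *)

Section lebesgue_measure_on_tuples.
Context {R : realType}.

Definition tcons n (p : R * n.-tuple R) : n.+1.-tuple R :=
  [tuple of p.1 :: p.2].

Lemma measurable_tcons n : measurable_fun setT (@tcons n).
Proof. exact: measurable_cons. Qed.

Section step.
Variables (n : nat) (mu : {sigma_finite_measure set (n.-tuple R) -> \bar R}).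

Definition lebesgue_tcons : set (n.+1.-tuple R) -> \bar R :=
  pushforward (lebesgue_measure \x mu)%E (@tcons n).

Let lebesgue_tcons0 : lebesgue_tcons set0 = 0%E.
Proof. by rewrite /lebesgue_tcons /pushforward preimage_set0 measure0. Qed.

Let lebesgue_tcons_ge0 A : (0 <= lebesgue_tcons A)%E.
Proof. by rewrite /lebesgue_tcons /pushforward; exact: measure_ge0. Qed.

Let lebesgue_tcons_sigma_additive : semi_sigma_additive lebesgue_tcons.
Proof.
move=> F mF tF mUF; rewrite /lebesgue_tcons /pushforward preimage_bigcup.
apply: measure_semi_sigma_additive.
- by move=> i; rewrite -[X in measurable X]setTI; exact: measurable_tcons.
- apply/trivIsetP => /= i j _ _ ij; rewrite -preimage_setI.
  by move/trivIsetP : tF => /(_ _ _ _ _ ij) ->//; rewrite preimage_set0.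
- rewrite -preimage_bigcup -[X in measurable X]setTI.
  exact: measurable_tcons.
Qed.

HB.instance Definition _ := isMeasure.Build _ _ _ lebesgue_tcons
  lebesgue_tcons0 lebesgue_tcons_ge0 lebesgue_tcons_sigma_additive.

Let lebesgue_tcons_sigma_finite : sigma_finite setT lebesgue_tcons.
Proof.
pose uncons (t : n.+1.-tuple R) : R * n.-tuple R :=
  (thead t, [tuple of behead t]).
have tK : cancel (@tcons n) uncons.
  by case=> x t; congr pair; apply: val_inj.
have munc : measurable_fun setT uncons.
  apply/measurable_fun_pairP; split => /=; first exact: measurable_tnth.
  exact: measurable_behead.
have /sigma_finiteP[F [TF ndF Foo]] :=
  sigma_finiteT (@lebesgue_measure R : {sigma_finite_measure set _ -> \bar R}).
have /sigma_finiteP[G [TG ndG Goo]] := sigma_finiteT mu.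
exists (fun i => uncons @^-1` (F i `*` G i)).
  rewrite -preimage_bigcup; apply/esym/seteqP; split => // t _.
  have : (\bigcup_i F i) (uncons t).1 by rewrite -TF.
  have : (\bigcup_i G i) (uncons t).2 by rewrite -TG.
  move=> -[k _ Gk] [i _ Fi]; exists (maxn i k) => //; split.
  - by move: Fi; exact/subsetPset/ndF/leq_maxl.
  - by move: Gk; exact/subsetPset/ndG/leq_maxr.
move=> i; have [mF Fioo] := Foo i; have [mG Gioo] := Goo i; split.
  by rewrite -[X in measurable X]setTI; apply: munc => //; exact: measurableX.
rewrite /lebesgue_tcons /pushforward -comp_preimage.
rewrite (_ : uncons \o _ = id); last by apply/funext => p /=; rewrite tK.
by rewrite product_measure1E// lte_mul_pinfty// ge0_fin_numE.
Qed.

HB.instance Definition _ := Measure_isSigmaFinite.Build _ _ _ lebesgue_tcons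
  lebesgue_tcons_sigma_finite.

End step.

Fixpoint lebesgue_tuple n : {sigma_finite_measure set (n.-tuple R) -> \bar R} :=
  match n with
  | 0 => \d_([tuple] : 0.-tuple R)
  | k.+1 => lebesgue_tcons (lebesgue_tuple k)
  end.

Lemma lebesgue_tuple_box n (B : 'I_n -> set R) :
  (forall i, measurable (B i)) ->
  lebesgue_tuple n [set x | forall i, B i (tnth x i)] =
  (\prod_(i < n) lebesgue_measure (B i))%E.
Proof.
elim: n B => [|n IH] B mB /=.
  by rewrite big_ord0 diracE mem_set//= => -[].
rewrite big_ord_recl /lebesgue_tcons /pushforward.
rewrite -(IH (fun i => B (lift ord0 i)))//.
rewrite -product_measure1E//; last first.
  rewrite (_ : [set _ | _] =
    \bigcap_(i in [set: 'I_n]) ((@tnth _ R ^~ i) @^-1` B (lift ord0 i))).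
    apply: fin_bigcap_measurable => // i _.
    by rewrite -[X in measurable X]setTI; exact: measurable_tnth.
  apply/seteqP; split => x /= H i; first by move=> _; exact: H.
  exact: H i I.
  exact: (mB ord0).
congr (product_measure1 _ _ _); apply/seteqP; split=> -[x t] /= H.
  split; first by have := H ord0.
  by move=> i; have := H (lift ord0 i); rewrite tnthS.
move=> i; case: (unliftP ord0 i) => [j|] ->; last exact: H.1.
by rewrite tnthS; exact: H.2.
Qed.

End lebesgue_measure_on_tuples.

(* Time ranges over the nonnegative elements of R. A real-valued process is a
   map R -> Omega -> R whose values at negative times are ignored. *)

Section processes.
Context {d : measure_display} {Omega : measurableType d} {R : realType}.
Variable P : probability Omega R.

Section brownian_motion.
Variable n : nat.
Implicit Type W : R -> Omega -> n.-tuple R.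

Definition increment W (s t : R) (w : Omega) : n.-tuple R :=
  [tuple tnth (W t w) i - tnth (W s w) i | i < n].

Definition past_events W (t : R) : set (set Omega) :=
  [set A | exists s B, [/\ 0 <= s, s <= t, measurable B & A = W s @^-1` B]].

(* In [bm_gauss], the values of the law N(0, (t - s) I_n) on boxes; the second
   parameter of [normal_prob] is the standard deviation. *)
Record standard_brownian_motion W : Prop := {
  bm_measurable : forall t, 0 <= t -> measurable_fun setT (W t) ;
  bm_start : \forall w \ae P, forall i, tnth (W 0 w) i = 0 ;
  bm_continuous : \forall w \ae P, forall i,
    {within `[0, +oo[, continuous (fun t => tnth (W t w) i)} ;
  bm_gauss : forall s t, 0 <= s -> s < t ->
    forall B : 'I_n -> set R, (forall i, measurable (B i)) ->
    P [set w | forall i, B i (tnth (increment W s t w) i)] =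
    (\prod_(i < n) normal_prob 0 (Num.sqrt (t - s)) (B i))%E ;
  bm_indep : forall s t, 0 <= s -> s < t ->
    forall (A : set Omega) (B : set (n.-tuple R)),
    <<s past_events W s >> A -> measurable B ->
    P (A `&` increment W s t @^-1` B) =
    (P A * P (increment W s t @^-1` B))%E }.

Definition brownian_filtration W (t : R) : set (set Omega) :=
  <<s past_events W t `|` [set N | measurable N /\ P N = 0%E] >>.

End brownian_motion.

Variable F : R -> set (set Omega).
Implicit Types X M A : R -> Omega -> R.

Definition adapted X := forall t, 0 <= t ->
  forall B : set R, measurable B -> F t (X t @^-1` B).

(* [martingale_eq] says that X s is a version of E[X t | F s]. *)
Record martingale X : Prop := {
  martingale_adapted : adapted X ;
  martingale_integrable : forall t, 0 <= t ->
    P.-integrable setT (EFin \o X t) ;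
  martingale_eq : forall s t, 0 <= s -> s <= t -> forall E, F s E ->
    (\int[P]_(w in E) (X t w)%:E = \int[P]_(w in E) (X s w)%:E)%E }.

Definition vector_martingale m (X : R -> Omega -> m.-tuple R) :=
  forall j : 'I_m, martingale (fun t w => tnth (X t w) j).

Definition stopping_time (tau : Omega -> \bar R) :=
  (forall w, 0 <= tau w)%E /\
  forall t, 0 <= t -> F t [set w | (tau w <= t%:E)%E].

Definition stopped X (tau : Omega -> \bar R) (t : R) (w : Omega) : R :=
  X (fine (mine t%:E (tau w))) w.

Definition local_martingale X :=
  exists tau : nat -> Omega -> \bar R,
    [/\ forall k, stopping_time (tau k),
        \forall w \ae P, forall k, (tau k w <= tau k.+1 w)%E,
        \forall w \ae P, tau ^~ w @ \oo --> +oo%E &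
        forall k, martingale (stopped X (tau k))].

(* The predictable sigma-algebra on [0, +oo[ x Omega. *)
Definition predictable_sigma_algebra : set (set (R * Omega)) :=
  <<s `[0, +oo[ `*` setT,
    [set C | exists2 E, F 0 E & C = [set 0] `*` E] `|`
    [set C | exists s t E, [/\ 0 <= s, s <= t, F s E & C = `]s, t] `*` E]] >>.

Definition predictable X := forall B : set R, measurable B ->
  predictable_sigma_algebra
    ((`[0, +oo[ `*` setT) `&` [set p | B (X p.1 p.2)]).

(* The defining properties of A = <M>, which determine A up to
   indistinguishability (Doob-Meyer). *)
Record predictable_quadratic_variation M A : Prop := {
  pqv_predictable : predictable A ;
  pqv_start : \forall w \ae P, A 0 w = 0 ;
  pqv_nondecreasing : \forall w \ae P, forall s t, 0 <= s -> s <= t ->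
    A s w <= A t w ;
  pqv_right_continuous : \forall w \ae P, forall t, 0 <= t ->
    A ^~ w @ t^'+ --> A t w ;
  pqv_local_martingale : local_martingale (fun t w => M t w ^+ 2 - A t w) }.

Record continuous_modification M M' : Prop := {
  cmod_adapted : adapted M' ;
  cmod_eq : forall t, 0 <= t -> \forall w \ae P, M' t w = M t w ;
  cmod_continuous : \forall w \ae P,
    {within `[0, +oo[, continuous (M' ^~ w)} }.

Definition square_characteristic M A :=
  exists2 M', continuous_modification M M' &
    predictable_quadratic_variation M' A.

Definition nonincreasing_process X :=
  \forall w \ae P, forall s t, 0 <= s -> s <= t -> X t w <= X s w.

End processes.

(* Main.v *)
Require Import Defs.
From HB Require Import structures.
From mathcomp Require Import all_boot all_order all_algebra.
From mathcomp Require Import all_classical all_reals all_analysis.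
From mathcomp Require Import measurable_realfun.
From mathcomp Require Import ring lra.

Set Implicit Arguments.
Unset Strict Implicit.
Unset Printing Implicit Defensive.

Import Order.TTheory GRing.Theory Num.Theory.
Import numFieldNormedType.Exports.

Local Open Scope classical_set_scope.
Local Open Scope ring_scope.

(** Write g for a component of f.  The idea is a quantitative Liouville theorem
    for functions that are invariant under every Gaussian smoothing and grow at
    most linearly in mean square.

    The martingale property, together with the independence and normality of
    the increments of W, says that for each s > 0 almost every x satisfies
    g(x) = E g(x + sZ), with Z standard normal on R^n ([ae_harmonic]).  The
    bound on the square characteristic is used only through its effect on
    second moments: optional stopping along a localizing sequence and Fatou's
    lemma give E g(W_t)^2 <= K + |C| t ([second_moment_le]), so the mean square
    of g(sZ) grows at most like s^2.

    Shifting a Gaussian is the same as reweighting it by the exponential factor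
    [tilt] (Cameron-Martin, [ge0_integral_gauss_translate]).  Hence for finitely
    many points x_i with g(x_i) = E g(x_i + sZ), a combination of values is a
    single scalar product in L^2 of the Gaussian measure:
      sum_i c_i g(x_i) = E [ g(sZ) * sum_i c_i tilt_i(sZ) ],
    and the scalar products of the tilts are explicit, E [ tilt_i tilt_j ] =
    exp(x_i.x_j / s^2).  If sum_i c_i = 0 and sum_i c_i x_i = 0, the terms of
    order 0 and 1 in this exponential cancel and the second factor has squared
    norm O(s^-4) ([integral_tilt_combination_le]).  The first has squared norm
    O(s^2), so the scalar product is O(1/s), and letting s grow yields
    sum_i c_i g(x_i) = 0 ([affine_relation_harmonic]).

    So g respects all affine relations between points of a set of full measure.
    That set contains, for every i, a pair of points q_i and q_i + e_i that
    differ by a basis vector, because Lebesgue measure is translation invariant;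
    expressing any other point of the set through these pairs shows that g is
    affine on it ([ae_affine]). *)

(** * Lebesgue measure on tuples *)

(** Pushforwards are measures only along bundled measurable functions. *)
Definition bundle_mfun d1 d2 (T1 : measurableType d1) (T2 : measurableType d2)
    (f : T1 -> T2) (mf : measurable_fun setT f) : {mfun T1 >-> T2} :=
  HB.pack f (isMeasurableFun.Build _ _ _ _ f mf).

Section lebesgue_tuple_theory.
Context {R : realType}.
Local Notation leb := (@lebesgue_measure R).

(** The measure on (n+1)-tuples is the image of a product measure, so that
    Tonelli reduces its integrals to one real variable and an n-tuple; the
    statements below go by induction on n through this step. *)
Lemma ge0_integral_lebesgue_tupleS n (F : n.+1.-tuple R -> \bar R) :
  measurable_fun setT F -> (forall x, 0 <= F x)%E ->
  (\int[lebesgue_tuple n.+1]_x F x =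
   \int[lebesgue_tuple n]_t \int[leb]_x F (tcons (x, t)))%E.
Proof.
move=> mF F0.
rewrite /= /lebesgue_tcons ge0_integral_pushforward//; last exact: measurable_tcons.
rewrite preimage_setT fubini_tonelli2//.
  apply: measurableT_comp => //; exact: measurable_tcons.
  by move=> x; exact: F0.
Qed.

Lemma measurable_integral_tcons n (F : n.+1.-tuple R -> \bar R) :
  measurable_fun setT F -> (forall x, 0 <= F x)%E ->
  measurable_fun setT (fun t => \int[leb]_x F (tcons (x, t)))%E.
Proof.
move=> mF F0.
apply: (@measurable_fun_fubini_tonelli_G _ _ _ _ _ leb (F \o (@tcons R n))) => //.
  by apply: measurableT_comp => //; exact: measurable_tcons.
by move=> x; exact: F0.
Qed.

Lemma measurable_translation (a : R) :
  measurable_fun setT (+%R a : measurableTypeR R -> measurableTypeR R).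
Proof. exact: measurable_funD. Qed.

(** A translate of an interval has the same length, and intervals determine
    Lebesgue measure. *)
Lemma lebesgue_measureD (a : R) (A : set R) : measurable A ->
  pushforward leb (+%R a : measurableTypeR R -> measurableTypeR R) A = leb A.
Proof.
move=> mA; apply/esym.
apply: (@lebesgue_measure_unique _
  (pushforward leb (bundle_mfun (measurable_translation a)))) => //= _ [[u v]] _ <-.
rewrite /pushforward.
rewrite (_ : _ @^-1` _ = [set` Interval (BRight (u - a)) (BRight (v - a))]); last first.
  by apply/seteqP; split => x /=; rewrite !in_itv/= ltrBlDl lerBrDl.
by rewrite !lebesgue_measure_itv/= !lte_fin ltrD2r -!EFinD opprB addrA subrK.
Qed.

Lemma ge0_integral_shift1 (a : R) (f : R -> \bar R) : measurable_fun setT f ->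
  (forall x, 0 <= f x)%E ->
  (\int[leb]_x f (a + x)%R = \int[leb]_x f x)%E.
Proof.
move=> mf f0.
rewrite -(ge0_integral_pushforward (measurable_translation a) leb measurableT mf)//.
apply: eq_measure_integral => [|? A mA _]; first exact: measurable_translation.
exact: lebesgue_measureD.
Qed.

Definition translate n (a x : n.-tuple R) : n.-tuple R :=
  [tuple tnth a i + tnth x i | i < n].

Lemma measurable_translate n (a : n.-tuple R) : measurable_fun setT (translate a).
Proof.
apply/measurable_fun_tnthP => i.
rewrite (_ : _ \o _ = fun x => tnth a i + tnth x i); last first.
  by apply/funext => x /=; rewrite tnth_mktuple.
by apply: measurable_funD => //; exact: measurable_tnth.
Qed.

Lemma translate_tcons n (a x : R) (b t : n.-tuple R) :
  translate (tcons (a, b)) (tcons (x, t)) = tcons (a + x, translate b t).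
Proof.
apply: eq_from_tnth => i; rewrite tnth_mktuple.
by case: (unliftP ord0 i) => [j|] ->; rewrite ?tnthS ?tnth0// tnth_mktuple.
Qed.

Lemma ge0_integral_translate n (a : n.-tuple R) (F : n.-tuple R -> \bar R) :
  measurable_fun setT F -> (forall x, 0 <= F x)%E ->
  (\int[lebesgue_tuple n]_x F (translate a x) = \int[lebesgue_tuple n]_x F x)%E.
Proof.
elim: n a F => [|n IH] a F mF F0.
  by apply: eq_integral => x _; rewrite [x]tuple0 [translate _ _]tuple0.
rewrite !ge0_integral_lebesgue_tupleS//; last first.
  by apply: measurableT_comp => //; exact: measurable_translate.
rewrite -[RHS](IH [tuple of behead a]); last 2 first.
- exact: measurable_integral_tcons.
- by move=> t; apply: integral_ge0.
apply: eq_integral => t _.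
rewrite -[RHS](ge0_integral_shift1 (thead a))//; last first.
  apply: measurableT_comp => //.
  by apply: measurable_cons => //; exact: measurable_id.
apply: eq_integral => x _.
by rewrite -translate_tcons; congr (F (translate _ _)); rewrite [LHS]tuple_eta; exact: val_inj.
Qed.

Lemma ge0_integral_prod n (k : 'I_n -> R -> R) :
  (forall i, measurable_fun setT (k i)) -> (forall i x, 0 <= k i x) ->
  (\int[lebesgue_tuple n]_x (\prod_(i < n) k i (tnth x i))%:E =
   \prod_(i < n) \int[leb]_x (k i x)%:E)%E.
Proof.
move=> mk k0; elim: n k mk k0 => [|n IH] k mk k0.
  under eq_integral do rewrite big_ord0.
  by rewrite big_ord0 /= integral_cst//= mul1e diracT.
rewrite ge0_integral_lebesgue_tupleS; last 2 first.
- apply/measurable_EFinP; apply: measurable_prod => i _.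
  by apply: measurableT_comp => //; exact: measurable_tnth.
- by move=> x; rewrite lee_fin prodr_ge0.
rewrite big_ord_recl.
rewrite -(IH (fun i => k (lift ord0 i)))//.
rewrite -ge0_integralZl//=; last 3 first.
- apply/measurable_EFinP; apply: measurable_prod => i _.
  by apply: measurableT_comp => //; exact: measurable_tnth.
- by move=> x _; rewrite lee_fin prodr_ge0.
- by apply: integral_ge0 => x _; rewrite lee_fin.
apply: eq_integral => t _.
have mk0 : measurable_fun [set: R] (fun x => (k ord0 x)%:E).
  exact/measurable_EFinP.
rewrite -ge0_integralZr//=; last 2 first.
- by move=> x _; rewrite lee_fin.
- by rewrite lee_fin prodr_ge0.
apply: eq_integral => x _.
rewrite big_ord_recl EFinM; congr (_%:E * _%:E)%E.
by apply: eq_bigr => i _; rewrite tnthS.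
Qed.

End lebesgue_tuple_theory.

(** * Gaussian measures and their translates *)

Section gaussian.
Context {R : realType}.
Local Notation leb := (@lebesgue_measure R).
Implicit Type s : R.

Definition gauss_pdf n s (y : n.-tuple R) : R :=
  \prod_(i < n) normal_pdf 0 s (tnth y i).

Lemma gauss_pdf_ge0 n s (y : n.-tuple R) : 0 <= gauss_pdf s y.
Proof. by apply: prodr_ge0 => i _; exact: normal_pdf_ge0. Qed.

Lemma gauss_pdf_gt0 n s (y : n.-tuple R) : s != 0 -> 0 < gauss_pdf s y.
Proof.
move=> s0; apply: prodr_gt0 => i _.
by rewrite normal_pdfE// mulr_gt0// ?normal_peak_gt0// expR_gt0.
Qed.

Lemma measurable_gauss_pdf n s :
  measurable_fun [set: n.-tuple R] (@gauss_pdf n s).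
Proof.
apply: measurable_prod => i _.
apply: measurableT_comp; first exact: measurable_normal_pdf.
exact: measurable_tnth.
Qed.

Definition gauss_prob n s : set (n.-tuple R) -> \bar R :=
  fun A => (\int[lebesgue_tuple n]_(x in A) (gauss_pdf s x)%:E)%E.

(** On a box the density is a product of functions of one coordinate each. *)
Lemma gauss_prob_box n s (B : 'I_n -> set R) : (forall i, measurable (B i)) ->
  gauss_prob s [set x | forall i, B i (tnth x i)] =
  (\prod_(i < n) normal_prob 0 s (B i))%E.
Proof.
move=> mB; rewrite /gauss_prob /normal_prob integral_mkcond.
transitivity (\int[lebesgue_tuple n]_x
    (\prod_(i < n) (normal_pdf 0 s \_ (B i)) (tnth x i))%:E)%E.
  apply: eq_integral => x _; rewrite patchE.
  case: ifPn => [/set_mem/= Bx|/negP Bx].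
    by congr _%:E; apply: eq_bigr => i _; rewrite patchE mem_set.
  have [i Bi] : exists i, ~ B i (tnth x i).
    by apply/existsNP => Bx'; apply: Bx; rewrite inE.
  rewrite (bigD1 i)//= patchE memNset// mul0r//.
rewrite (@ge0_integral_prod _ _ (fun i => normal_pdf 0 s \_ (B i))).

- apply: eq_bigr => i _; rewrite [RHS]integral_mkcond.
  by apply: eq_integral => x _; rewrite !patchE; case: ifP.
- move=> i; apply/(measurable_restrictT _ (mB i)).
  apply: measurable_funTS; exact: measurable_normal_pdf.
- move=> i x; rewrite patchE; case: ifP => // _; exact: normal_pdf_ge0.
Qed.

Let gauss0 n s : @gauss_prob n s set0 = 0%E.
Proof. by rewrite /gauss_prob integral_set0. Qed.

Let gauss_ge0 n s A : (0 <= @gauss_prob n s A)%E.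
Proof. by apply: integral_ge0 => x _; rewrite lee_fin gauss_pdf_ge0. Qed.

Let gauss_sigma_additive n s : semi_sigma_additive (@gauss_prob n s).
Proof.
apply: semi_sigma_additive_nng_induced.
  apply/measurable_EFinP; exact: measurable_gauss_pdf.
by move=> x; rewrite lee_fin gauss_pdf_ge0.
Qed.

HB.instance Definition _ n s := isMeasure.Build _ _ _
  (@gauss_prob n s) (@gauss0 n s) (@gauss_ge0 n s) (@gauss_sigma_additive n s).

Let gauss_setT n s : @gauss_prob n s setT = 1%E.
Proof.
have := @gauss_prob_box n s (fun=> setT) (fun=> measurableT).
rewrite (_ : [set _ | _] = setT); last by apply/seteqP.
by move=> ->; rewrite big1// => i _; rewrite probability_setT.
Qed.

HB.instance Definition _ n s :=
  @Measure_isProbability.Build _ _ R (@gauss_prob n s) (@gauss_setT n s).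

Lemma gauss_prob_dominates n s : @gauss_prob n s `<< lebesgue_tuple n.
Proof.
apply/null_content_dominatesP => A mA A0; apply: null_set_integral => //=.
apply/measurable_funTS/measurable_EFinP; exact: measurable_gauss_pdf.
Qed.

(** The density is positive everywhere, so Gaussian null sets are Lebesgue null;
    this is how statements about the law of W_1 become Lebesgue almost
    everywhere statements. *)
Lemma dominates_gauss_prob n s (N : set (n.-tuple R)) : s != 0 -> measurable N ->
  gauss_prob s N = 0%E -> lebesgue_tuple n N = 0%E.
Proof.
move=> s0 mN N0.
have mpdf : measurable_fun N (fun x => (gauss_pdf s x)%:E).
  apply/measurable_funTS/measurable_EFinP; exact: measurable_gauss_pdf.
have := (ae_eq_integral_abs (lebesgue_tuple n) mN mpdf).1.
have -> : (\int[lebesgue_tuple n]_(x in N) `|(gauss_pdf s x)%:E| = 0)%E.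
  rewrite -N0; apply: eq_integral => x _.
  by rewrite gee0_abs// lee_fin gauss_pdf_ge0.
move=> /(_ erefl) ae0; apply/negligibleP => //.
apply: negligibleS ae0 => x Nx /= /(_ Nx) [] px0.
by have := gauss_pdf_gt0 x s0; rewrite px0 ltxx.
Qed.

(** Both the density and the Radon-Nikodym derivative integrate to the Gaussian
    measure over every measurable set, hence they agree almost everywhere and
    the change of variables formula for the latter applies to the former. *)
Lemma ge0_integral_gauss n s (F : n.-tuple R -> \bar R) :
  measurable_fun setT F -> (forall x, 0 <= F x)%E ->
  (\int[gauss_prob s]_x F x =
   \int[lebesgue_tuple n]_x (F x * (gauss_pdf s x)%:E))%E.
Proof.
move=> mF F0.
have dom := @gauss_prob_dominates n s.
rewrite -(Radon_Nikodym_SigmaFinite.change_of_variables dom)//.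
have mpdf : measurable_fun [set: n.-tuple R] (fun x => (gauss_pdf s x)%:E).
  apply/measurable_EFinP; exact: measurable_gauss_pdf.
have mf := measurable_int _ (Radon_Nikodym_SigmaFinite.f_integrable dom).
apply: ge0_ae_eq_integral => //.
- exact: emeasurable_funM.
- exact: emeasurable_funM.
- by move=> x _; rewrite mule_ge0// Radon_Nikodym_SigmaFinite.f_ge0.
- by move=> x _; rewrite mule_ge0// lee_fin gauss_pdf_ge0.
apply: ae_eqe_mul2l; apply: integral_ae_eq => //.
  exact: Radon_Nikodym_SigmaFinite.f_integrable.
by move=> E _ mE; rewrite -Radon_Nikodym_SigmaFinite.f_integral.
Qed.

Definition dot n (x y : n.-tuple R) : R := \sum_(i < n) tnth x i * tnth y i.

Lemma dot_translatel n (a x y : n.-tuple R) : dot (translate a x) y = dot a y + dot x y.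
Proof.
by rewrite -big_split; apply: eq_bigr => i _; rewrite tnth_mktuple mulrDl.
Qed.

Lemma dotC n (x y : n.-tuple R) : dot x y = dot y x.
Proof. by apply: eq_bigr => i _; rewrite mulrC. Qed.

Lemma measurable_dot n (x : n.-tuple R) : measurable_fun setT (dot x).
Proof.
apply: measurable_sum => i; apply: measurable_funM => //.
exact: measurable_tnth.
Qed.

(** The density of N(x, s^2 I) with respect to N(0, s^2 I). *)
Definition tilt n s (x y : n.-tuple R) : R :=
  expR ((dot x y - dot x x / 2) / s ^+ 2).

Lemma tilt_ge0 n s (x y : n.-tuple R) : 0 <= tilt s x y.
Proof. exact: expR_ge0. Qed.

Lemma measurable_tilt n s (x : n.-tuple R) : measurable_fun setT (tilt s x).
Proof.
apply: measurableT_comp => //; apply: measurable_funM => //.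
by apply: measurable_funB => //; exact: measurable_dot.
Qed.

(** Completing the square. *)
Lemma tiltM n s (x z y : n.-tuple R) :
  tilt s x y * tilt s z y = expR (dot x z / s ^+ 2) * tilt s (translate x z) y.
Proof.
rewrite /tilt -!expRD; congr expR.
rewrite !dot_translatel !(dotC _ (translate _ _)) !dot_translatel (dotC z x).
rewrite -!mulrDl; congr (_ / _); by field.
Qed.

Lemma gauss_pdf_translate n s (x y : n.-tuple R) : s != 0 ->
  gauss_pdf s y = tilt s x (translate x y) * gauss_pdf s (translate x y).
Proof.
move=> s0; rewrite /gauss_pdf /tilt /dot mulr_suml -sumrB mulr_suml expR_sum.
rewrite -big_split; apply: eq_bigr => i _ /=.
rewrite !normal_pdfE// /normal_fun !tnth_mktuple !subr0 mulrCA -expRD.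
by congr (_ * expR _); field.
Qed.

(** The Cameron-Martin formula: [gauss_pdf_translate] and the translation
    invariance of Lebesgue measure. *)
Lemma ge0_integral_gauss_translate n s (x : n.-tuple R) (F : n.-tuple R -> \bar R) :
  s != 0 -> measurable_fun setT F -> (forall y, 0 <= F y)%E ->
  (\int[gauss_prob s]_y F (translate x y) =
   \int[gauss_prob s]_y (F y * (tilt s x y)%:E))%E.
Proof.
move=> s0 mF F0.
have mt : measurable_fun [set: n.-tuple R] (fun y => (tilt s x y)%:E).
  apply/measurable_EFinP; exact: measurable_tilt.
have mp : measurable_fun [set: n.-tuple R] (fun y => (gauss_pdf s y)%:E).
  apply/measurable_EFinP; exact: measurable_gauss_pdf.
rewrite !ge0_integral_gauss//; last 3 first.
- exact: emeasurable_funM.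
- by move=> y; rewrite mule_ge0// lee_fin tilt_ge0.
- by apply: measurableT_comp => //; exact: measurable_translate.
rewrite -[RHS](ge0_integral_translate x).
- apply: eq_integral => y _.
  by rewrite (gauss_pdf_translate x y s0) EFinM muleA.
- by apply: emeasurable_funM => //; exact: emeasurable_funM.
- by move=> y; rewrite !mule_ge0// lee_fin ?tilt_ge0 ?gauss_pdf_ge0.
Qed.

(** The tilt is nonnegative, so it commutes with positive and negative parts and the
    formula passes from nonnegative to signed functions. *)
Lemma integral_gauss_translate n s (x : n.-tuple R) (F : n.-tuple R -> R) :
  s != 0 -> measurable_fun setT F ->
  (\int[gauss_prob s]_y (F (translate x y))%:E =
   \int[gauss_prob s]_y (F y * tilt s x y)%:E)%E.
Proof.
move=> s0 mF.
have mEF : measurable_fun setT (EFin \o F) by exact/measurable_EFinP.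
have maxM (r t : R) : 0 <= t -> (maxe (r * t)%:E 0 = maxe r%:E 0 * t%:E)%E.
  by move=> t0; rewrite -!EFin_max -EFinM maxr_pMl// mul0r.
rewrite integralE [RHS]integralE; congr (_ - _)%E.
- transitivity (\int[gauss_prob s]_y ((EFin \o F)^\+ (translate x y)))%E.
    by apply: eq_integral => y _; rewrite ?funeposE ?funenegE.
  rewrite ge0_integral_gauss_translate//; last exact: measurable_funepos.
  by apply: eq_integral => y _; rewrite !funeposE/= maxM// tilt_ge0.
- transitivity (\int[gauss_prob s]_y ((EFin \o F)^\- (translate x y)))%E.
    by apply: eq_integral => y _; rewrite ?funeposE ?funenegE.
  rewrite ge0_integral_gauss_translate//; last exact: measurable_funeneg.
  by apply: eq_integral => y _; rewrite !funenegE/= -mulNr maxM// tilt_ge0.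
Qed.

Lemma integral_tilt n s (x : n.-tuple R) : s != 0 ->
  (\int[gauss_prob s]_y (tilt s x y)%:E = 1)%E.
Proof.
move=> s0.
transitivity (\int[@gauss_prob n s]_y (cst 1%E y * (tilt s x y)%:E))%E.
  by apply: eq_integral => y _; rewrite mul1e.
rewrite -ge0_integral_gauss_translate//.
by rewrite integral_cst//= probability_setT mule1.
Qed.

Lemma integral_tiltM n s (x z : n.-tuple R) : s != 0 ->
  (\int[gauss_prob s]_y (tilt s x y * tilt s z y)%:E =
   (expR (dot x z / s ^+ 2))%:E)%E.
Proof.
move=> s0; under eq_integral do rewrite tiltM EFinM.
rewrite ge0_integralZl_EFin//.
- by rewrite integral_tilt// mule1.
- by move=> y _; rewrite lee_fin tilt_ge0.
- apply/measurable_EFinP; exact: measurable_tilt.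
Qed.

End gaussian.

(** * Affine relations between values of a harmonic function *)

Section liouville.
Context {R : realType}.

(** The upper bound comes from expR z <= 1 / (1 - z), a consequence of
    1 - z <= expR (- z). *)
Lemma expR_sub_affine_le (z : R) : `|z| <= 2^-1 ->
  `|expR z - 1 - z| <= 2 * z ^+ 2.
Proof.
rewrite ler_norml => /andP[zl zr].
have e1 := expR_ge1Dx z; have e2 := expR_ge1Dx (- z).
rewrite ger0_norm; last lra.
have e3 : expR z * (1 - z) <= 1.
  have -> : 1 = expR z * expR (- z) :> R by rewrite -expRD subrr expR0.
  by rewrite ler_pM2l ?expR_gt0// -expRD subrr expR0.
have e4 : expR z * (1 - z) <= (1 + z + 2 * z ^+ 2) * (1 - z).
  apply: le_trans e3 _; have := sqr_ge0 z; nra.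
suff : expR z <= 1 + z + 2 * z ^+ 2 by lra.
by rewrite -(ler_pM2r (_ : 0 < 1 - z))//; lra.
Qed.

Lemma measurable_square d (T : measurableType d) (h : T -> R) :
  measurable_fun setT h -> measurable_fun setT (fun y => (h y ^+ 2)%:E).
Proof. by move=> mh; apply/measurable_EFinP; exact: measurable_funX. Qed.

Lemma integrable_square d (T : measurableType d) (mu : {measure set T -> \bar R})
    (h : T -> R) : measurable_fun setT h ->
  (\int[mu]_y (h y ^+ 2)%:E < +oo)%E ->
  mu.-integrable setT (fun y => (h y ^+ 2)%:E).
Proof.
move=> mh hoo; apply/integrableP; split; first exact: measurable_square.
by under eq_integral do rewrite gee0_abs ?lee_fin ?sqr_ge0//.
Qed.

Lemma integrable_mul d (T : measurableType d) (mu : {measure set T -> \bar R})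
    (h1 h2 : T -> R) :
  measurable_fun setT h1 -> measurable_fun setT h2 ->
  (\int[mu]_y (h1 y ^+ 2)%:E < +oo)%E -> (\int[mu]_y (h2 y ^+ 2)%:E < +oo)%E ->
  mu.-integrable setT (fun y => (h1 y * h2 y)%:E).
Proof.
move=> m1 m2 oo1 oo2.
apply: (le_integrable measurableT _ _
  (integrableD measurableT (integrable_square m1 oo1) (integrable_square m2 oo2))).
  by apply/measurable_EFinP; exact: measurable_funM.
move=> y _ /=; rewrite lee_fin [leRHS]ger0_norm; last first.
  by rewrite addr_ge0// sqr_ge0.
rewrite ler_norml; apply/andP; split; nra.
Qed.

(** A substitute for the Cauchy-Schwarz inequality, from the pointwise bound
    |uv| <= u^2/e + e v^2; the free weight e balances a large first factor
    against a small second one. *)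
Lemma integral_mul_le d (T : measurableType d) (mu : {measure set T -> \bar R})
    (h1 h2 : T -> R) (e a b : R) : 0 < e ->
  measurable_fun setT h1 -> measurable_fun setT h2 ->
  (\int[mu]_y (h1 y ^+ 2)%:E <= a%:E)%E -> (\int[mu]_y (h2 y ^+ 2)%:E <= b%:E)%E ->
  (`| \int[mu]_y (h1 y * h2 y)%:E | <= (e^-1 * a + e * b)%:E)%E.
Proof.
move=> e0 m1 m2 la lb.
have m12 : measurable_fun setT (fun y => (h1 y * h2 y)%:E).
  by apply/measurable_EFinP; exact: measurable_funM.
apply: le_trans (le_abse_integral _ _ _) _ => //.
have mm1 := measurable_square m1; have mm2 := measurable_square m2.
have ei0 : 0 <= e^-1 by rewrite invr_ge0 ltW.
apply: (@le_trans _ _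
  (\int[mu]_y (e^-1%:E * (h1 y ^+ 2)%:E + e%:E * (h2 y ^+ 2)%:E))%E).
  apply: ge0_le_integral => //.
  - exact: measurableT_comp.
  - by apply: emeasurable_funD; exact: measurable_funeM.
  - move=> y _; rewrite lee_fin.
    have ee : e * e^-1 = 1 by rewrite divff// gt_eqF.
    set u := h1 y; set v := h2 y.
    have -> : e^-1 * u ^+ 2 + e * v ^+ 2 = e * ((e^-1 * u) ^+ 2 + v ^+ 2).
      by field; rewrite gt_eqF.
    have -> : `|u * v| = e * `|(e^-1 * u) * v|.
      by rewrite !normrM (ger0_norm ei0) !mulrA divff ?gt_eqF// mul1r.
    rewrite ler_pM2l// ler_norml; apply/andP; split; nra.
rewrite ge0_integralD//; last 4 first.
- by move=> y _; rewrite mule_ge0// lee_fin// sqr_ge0.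
- exact: measurable_funeM.
- by move=> y _; rewrite mule_ge0// lee_fin ?sqr_ge0// ltW.
- exact: measurable_funeM.
rewrite !ge0_integralZl_EFin//; last 3 first.
- by move=> y _; rewrite lee_fin sqr_ge0.
- exact: ltW.
- by move=> y _; rewrite lee_fin sqr_ge0.
rewrite EFinD !EFinM; by apply: leeD; apply: lee_wpmul2l; rewrite ?lee_fin// ltW.
Qed.

Lemma affine_relation_dot n (I : finType) (c : I -> R) (x : I -> n.-tuple R) :
  (forall l, \sum_i c i * tnth (x i) l = 0) ->
  \sum_(p : I * I) c p.1 * c p.2 * dot (x p.1) (x p.2) = 0.
Proof.
move=> c1.
rewrite -(pair_bigA _ (fun i j => c i * c j * dot (x i) (x j)))/=.
rewrite big1// => i _; under eq_bigr do rewrite -mulrA mulr_sumr.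
rewrite -mulr_sumr exchange_big/= big1 ?mulr0// => l _.
under eq_bigr do rewrite mulrCA; by rewrite -mulr_sumr c1 mulr0.
Qed.

(** Expanding the square gives the sum over i, j of c_i c_j exp(x_i.x_j / s^2).
    The two relations on c remove the constant and linear terms of the
    exponential, and the quadratic remainder is O(s^-4). *)
Lemma integral_tilt_combination_le n (I : finType) (c : I -> R)
    (x : I -> n.-tuple R) :
  \sum_i c i = 0 -> (forall l, \sum_i c i * tnth (x i) l = 0) ->
  exists D : R, 0 <= D /\ forall s : R, 1 <= s -> D <= s ->
   (\int[gauss_prob s]_y ((\sum_i c i * tilt s (x i) y) ^+ 2)%:E <=
    (D / s ^+ 4)%:E)%E.
Proof.
move=> c0 c1.
pose M := \sum_(p : I * I) `|dot (x p.1) (x p.2)|.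
pose D := \sum_(p : I * I) `|c p.1 * c p.2| * (2 * dot (x p.1) (x p.2) ^+ 2).
have M0 : 0 <= M by apply: sumr_ge0.
have D0 : 0 <= D.
  by apply: sumr_ge0 => p _; rewrite mulr_ge0// mulr_ge0// sqr_ge0.
exists (D + 2 * M); split; first by rewrite addr_ge0// mulr_ge0.
move=> s s1 sD.
have s0 : 0 < s by lra.
have sn0 : s != 0 by rewrite gt_eqF.
under eq_integral => y _.
  rewrite expr2 mulr_suml.
  under eq_bigr do rewrite mulr_sumr.
  rewrite (pair_bigA _ (fun i j => c i * tilt s (x i) y * (c j * tilt s (x j) y)))/=.
  rewrite -sumEFin.
  under eq_bigr do rewrite mulrACA EFinM.
  over.
have mt (p : I * I) : measurable_fun setT
    (fun y => (tilt s (x p.1) y * tilt s (x p.2) y)%:E).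
  by apply/measurable_EFinP; apply: measurable_funM; exact: measurable_tilt.
have it (p : I * I) : (gauss_prob s).-integrable setT
    (fun y => (tilt s (x p.1) y * tilt s (x p.2) y)%:E).
  apply/integrableP; split; first exact: mt.
  under eq_integral do rewrite gee0_abs ?lee_fin ?mulr_ge0 ?tilt_ge0//.
  by rewrite integral_tiltM// ltry.
rewrite integral_sum//; last by move=> p; exact: integrableZl.
under eq_bigr => p _ do rewrite integralZl// integral_tiltM// -EFinM.
rewrite sumEFin lee_fin.
have c00 : \sum_(p : I * I) c p.1 * c p.2 = 0.
  rewrite -(pair_bigA _ (fun i j => c i * c j))/=.
  by rewrite big1// => i _; rewrite -mulr_sumr c0 mulr0.
have -> : \sum_(p : I * I) c p.1 * c p.2 * expR (dot (x p.1) (x p.2) / s ^+ 2) =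
    \sum_(p : I * I) c p.1 * c p.2 *
     (expR (dot (x p.1) (x p.2) / s ^+ 2) - 1 - dot (x p.1) (x p.2) / s ^+ 2).
  under [RHS]eq_bigr do rewrite !mulrBr mulr1 mulrA.
  rewrite !sumrB c00 -mulr_suml (affine_relation_dot c1).
  by rewrite mul0r !subr0.
apply: (@le_trans _ _ (D / s ^+ 4)); last first.
  apply: ler_wpM2r; last by lra.
  by rewrite invr_ge0 exprn_ge0 // ltW.
apply: le_trans (ler_norm _) _; apply: le_trans (ler_norm_sum _ _ _) _.
rewrite /D mulr_suml; apply: ler_sum => p _.
rewrite normrM -mulrA; apply: ler_wpM2l => //.
apply: le_trans (expR_sub_affine_le _) _; last first.
  by rewrite expr_div_n -exprM mulrA.
rewrite normrM (ger0_norm (_ : 0 <= (s ^+ 2)^-1)) ?invr_ge0 ?sqr_ge0//.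
rewrite ler_pdivrMr ?exprn_gt0//.
have pM : `|dot (x p.1) (x p.2)| <= M.
  by rewrite /M (bigD1 p)//= lerDl sumr_ge0.
nra.
Qed.

(** The combination equals the integral of g against a combination of tilts.  With
    squared norms O(s^2) and O(s^-4) for the two factors and the weight e = s^3,
    [integral_mul_le] bounds it by (K + D) / s for arbitrarily large s. *)
Lemma affine_relation_harmonic n (g : n.-tuple R -> R) (K : R) (I : finType)
    (c : I -> R) (x : I -> n.-tuple R) :
  measurable_fun setT g ->
  (forall k : nat, (\int[gauss_prob k.+1%:R]_y (g y ^+ 2)%:E <=
                    (K * k.+1%:R ^+ 2)%:E)%E) ->
  (forall (i : I) (k : nat),
    ((g (x i))%:E = \int[gauss_prob k.+1%:R]_y (g (translate (x i) y))%:E)%E) ->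
  \sum_i c i = 0 -> (forall l, \sum_i c i * tnth (x i) l = 0) ->
  \sum_i c i * g (x i) = 0.
Proof.
move=> mg gK gx c0 c1.
have [D [D0 TD]] := integral_tilt_combination_le c0 c1.
have step k : D <= k.+1%:R ->
    `|\sum_i c i * g (x i)| <= (K + D) / k.+1%:R.
  set s : R := k.+1%:R => Ds.
  have s1 : 1 <= s by rewrite /s ler1n.
  have s0 : 0 < s by lra.
  have sn0 : s != 0 by rewrite gt_eqF.
  rewrite -lee_fin.
  have mt z : measurable_fun setT (@tilt _ n s z) by exact: measurable_tilt.
  have it i : (gauss_prob s).-integrable setT
      (fun y => (g y * tilt s (x i) y)%:E).
    apply: integrable_mul => //; first exact: le_lt_trans (gK k) (ltry _).
    under eq_integral do rewrite expr2.
    by rewrite integral_tiltM// ltry.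
  have -> : (`|\sum_i c i * g (x i)|%:E = `| \int[gauss_prob s]_y
      (g y * \sum_i c i * tilt s (x i) y)%:E |)%E.
    rewrite -abse_EFin; congr (`| _ |)%E; rewrite -sumEFin.
    under [RHS]eq_integral => y _.
      rewrite mulr_sumr -sumEFin.
      under eq_bigr do rewrite mulrCA EFinM.
      over.
    rewrite integral_sum//; last by move=> i; exact: integrableZl.
    apply: eq_bigr => i _; rewrite integralZl//.
    by rewrite -integral_gauss_translate// -gx.
  (* the weight s ^+ 3 makes both terms of the bound of order 1 / s *)
  have -> : (K + D) / s = (s ^+ 3)^-1 * (K * s ^+ 2) + s ^+ 3 * (D / s ^+ 4).
    by field.
  apply: integral_mul_le => //.
  - by rewrite exprn_gt0.
  - by apply: measurable_sum => i; apply: measurable_funM.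
  - exact: gK.
  - exact: TD.
apply/eqP/contraT; rewrite -normr_gt0 => S0.
pose k := Num.trunc (D + (`|K| + D) / `|\sum_i c i * g (x i)|).
have kD : D + (`|K| + D) / `|\sum_i c i * g (x i)| < k.+1%:R by exact: truncnS_gt.
have KS : 0 <= (`|K| + D) / `|\sum_i c i * g (x i)|.
  by rewrite divr_ge0// addr_ge0.
have k0 : 0 < k.+1%:R :> R by rewrite ltr0n.
have /step : D <= k.+1%:R by lra.
rewrite ler_pdivlMr// => le1.
have : (`|K| + D) / `|\sum_i c i * g (x i)| < k.+1%:R by lra.
rewrite ltr_pdivrMr// mulrC => lt2.
have := ler_norm K; lra.
Qed.

End liouville.

(** * From affine relations to almost everywhere affine functions *)

Section affine.
Context {R : realType}.

Lemma lebesgue_tuple_translate_null n (a : n.-tuple R) (N : set (n.-tuple R)) :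
  measurable N -> lebesgue_tuple n N = 0%E ->
  lebesgue_tuple n (translate a @^-1` N) = 0%E.
Proof.
move=> mN N0.
have mN' : measurable (translate a @^-1` N).
  by rewrite -[X in measurable X]setTI; exact: measurable_translate.
rewrite -(setIT (_ @^-1` _)) -integral_indic//.
transitivity (\int[lebesgue_tuple n]_x (\1_N (translate a x))%:E)%E.
  exact: eq_integral.
rewrite (@ge0_integral_translate R n a (fun x => (\1_N x)%:E)).
- by rewrite integral_indic// setIT.
- by apply/measurable_EFinP; exact: measurable_indic.
- by move=> x; rewrite lee_fin.
Qed.

Lemma ae_lebesgue_tuple_nonempty n (N : set (n.-tuple R)) :
  measurable N -> lebesgue_tuple n N = 0%E -> exists x, ~ N x.
Proof.
move=> mN N0; apply/existsNP => NT.
have : @gauss_prob R n 1 N = 0%E.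
  by move/null_content_dominatesP : (@gauss_prob_dominates R n 1); exact.
rewrite (_ : N = setT) ?probability_setT; last by apply/seteqP; split => x _ //; exact: NT.
by move/eqP; rewrite onee_eq0.
Qed.

(** A point x outside the exceptional set N satisfies
      x - x0 - sum_i (x - x0)_i ((q_i + e_i) - q_i) = 0
    with x0, q_i and q_i + e_i outside N as well; applying g to this affine
    relation expresses g x through finitely many fixed values of g. *)
Lemma ae_affine n (g : n.-tuple R -> R) (K : R) :
  measurable_fun setT g ->
  (forall k : nat, (\int[gauss_prob k.+1%:R]_y (g y ^+ 2)%:E <=
                    (K * k.+1%:R ^+ 2)%:E)%E) ->
  (\forall x \ae lebesgue_tuple n, forall k : nat,
    ((g x)%:E = \int[gauss_prob k.+1%:R]_y (g (translate x y))%:E)%E) ->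
  exists (a : 'I_n -> R) (b : R),
    \forall x \ae lebesgue_tuple n, g x = \sum_i a i * tnth x i + b.
Proof.
move=> mg gK [N [mN N0 NG]].
have G x : ~ N x -> forall k : nat,
    ((g x)%:E = \int[gauss_prob k.+1%:R]_y (g (translate x y))%:E)%E.
  by move=> Nx; apply: contrapT => H; apply: Nx; exact: NG.
pose e i : n.-tuple R := [tuple (j == i)%:R | j < n].
have /choice[q qN] : forall i, exists q, ~ N q /\ ~ N (translate (e i) q).
  (* neither N nor its translate by - e i carries mass, so some q avoids both *)
  move=> i; pose N' := translate (e i) @^-1` N.
  have mN' : measurable N'.
    by rewrite -[X in measurable X]setTI; exact: measurable_translate.
  have [|q Nq] := @ae_lebesgue_tuple_nonempty n (N `|` N') (measurableU _ _ mN mN').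
      apply/eqP; rewrite -measure_le0; apply: le_trans (measureU2 _ mN mN') _.
    have N'0 : lebesgue_tuple n N' = 0%E by exact: lebesgue_tuple_translate_null.
    by rewrite [X in (X + _)%E]N0 add0e [leLHS]N'0.
  by exists q; split => [Nq'|Nq']; apply: Nq; [left|right].
have [x0 Nx0] := ae_lebesgue_tuple_nonempty mN N0.
pose a i := g (translate (e i) (q i)) - g (q i).
exists a, (g x0 - \sum_i a i * tnth x0 i).
exists N; split => // x /= Hx; apply: contrapT => Nx; apply: Hx.
pose v i := tnth x i - tnth x0 i.
pose c (j : bool + ('I_n + 'I_n)) : R :=
  match j with inl b => (-1) ^+ b | inr (inl i) => - v i | inr (inr i) => v i end.
pose p (j : bool + ('I_n + 'I_n)) : n.-tuple R :=
  match j with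
  | inl b => if b then x0 else x
  | inr (inl i) => translate (e i) (q i)
  | inr (inr i) => q i
  end.
have := @affine_relation_harmonic R n g K _ c p mg gK.
rewrite !big_sumType !big_bool/=.
rewrite expr0 expr1 mul1r mulN1r.
move=> rel.
have {rel} : - g x0 + g x +
   (\sum_i - v i * g (translate (e i) (q i)) + \sum_i v i * g (q i)) = 0.
  apply: rel.
  - move=> [[]|[i|i]] k /=; apply: G => //; by have [] := qN i.
  - by rewrite addNr add0r sumrN addNr.
  - move=> l; rewrite !big_sumType !big_bool/= expr0 expr1 mul1r mulN1r.
    rewrite -big_split/=.
    under eq_bigr do rewrite !tnth_mktuple mulrDr mulNr -addrA mulNr addNr addr0.
    rewrite sumrN (bigD1 l)//= eqxx mulr1 big1 ?addr0 /v => [|i il]; last first.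
      by rewrite eq_sym (negbTE il) mulr0.
    ring.
rewrite -big_split/= => rel.
have -> : \sum_i a i * tnth x i = \sum_i a i * tnth x0 i + \sum_i v i * a i.
  rewrite -big_split/=; apply: eq_bigr => i _; rewrite /v; ring.
have : \sum_i (- v i * g (translate (e i) (q i)) + v i * g (q i)) =
    - \sum_i v i * a i.
  by rewrite -sumrN; apply: eq_bigr => i _; rewrite /a; ring.
move=> E; rewrite E in rel; lra.
Qed.

End affine.

(** * Second moments of a martingale with bounded square characteristic *)

Section second_moment.
Context {d : measure_display} {Omega : measurableType d} {R : realType}.
Variable P : probability Omega R.

Lemma stopped0 (X : R -> Omega -> R) (tau : Omega -> \bar R) w :
  (0 <= tau w)%E -> stopped X tau 0 w = X 0 w.
Proof. by move=> tau0; rewrite /stopped min_l. Qed.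

Lemma stopped_late (X : R -> Omega -> R) (tau : Omega -> \bar R) t w :
  (t%:E <= tau w)%E -> stopped X tau t w = X t w.
Proof. by move=> tau0; rewrite /stopped min_l. Qed.

Lemma stopped_time_itv (tau : \bar R) (t : R) : 0 <= t -> (0 <= tau)%E ->
  0 <= fine (mine t%:E tau) <= t.
Proof.
move=> t0 tau0; apply/andP; split.
  by rewrite fine_ge0// le_min lee_fin t0.
case: tau tau0 => [r| |]//= r0; last by rewrite min_l ?leey.
by rewrite -EFin_min /= ge_min lexx.
Qed.

(** The stopped processes M'^2 - A have constant expectation and A_t <= C t, so
    the nonnegative variables Z_k, the positive parts of (M'^2 - A) stopped at
    tau_k plus |C| t, all have mean K + |C| t.  As tau_k tends to infinity, Z_k
    is eventually above M_t^2, and Fatou's lemma concludes. *)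
Lemma second_moment_le (F : R -> set (set Omega)) (M M' A : R -> Omega -> R)
    (C : R) :
  F 0 setT ->
  (forall t, 0 <= t -> measurable_fun setT (M t)) ->
  continuous_modification P F M M' ->
  predictable_quadratic_variation P F M' A ->
  nonincreasing_process P (fun t w => A t w - C * t) ->
  exists K : R, forall t, 0 <= t ->
    (\int[P]_w (M t w ^+ 2)%:E <= (K + `|C| * t)%:E)%E.
Proof.
move=> F0T mM [_ MM' _] [_ A0 _ _ [tau [tau_st _ tau_oo tau_mart]]] Cdec.
pose N t w := M' t w ^+ 2 - A t w.
have N0int : P.-integrable setT (EFin \o N 0).
  have := martingale_integrable (tau_mart 0%N) (lexx 0).
  by congr (_.-integrable _ _); apply/funext => w /=; rewrite stopped0// (tau_st 0%N).1.
exists (fine (\int[P]_w (N 0 w)%:E)) => t t0.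
set K := fine _.
have KE : (\int[P]_w (N 0 w)%:E = K%:E)%E.
  by rewrite fineK//; exact: integrable_fin_num N0int.
have Nint k : P.-integrable setT (EFin \o stopped N (tau k) t).
  exact: (martingale_integrable (tau_mart k) t0).
have NE k : (\int[P]_w (stopped N (tau k) t w)%:E = K%:E)%E.
  rewrite (martingale_eq (tau_mart k) (lexx 0) t0 F0T) -KE.
  by apply: eq_integral => w _; rewrite stopped0// (tau_st k).1.
pose Y k w := stopped N (tau k) t w + `|C| * t.
have Yint k : P.-integrable setT (EFin \o Y k).
  rewrite (_ : _ \o _ = (EFin \o stopped N (tau k) t) \+ cst (`|C| * t)%:E)%E//.
  apply: integrableD => //; exact: finite_measure_integrable_cst.
have YE k : (\int[P]_w (Y k w)%:E = (K + `|C| * t)%:E)%E.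
  under eq_integral do rewrite EFinD.
  rewrite integralD//; [|exact: Nint|exact: finite_measure_integrable_cst].
  by rewrite NE integral_cst//= probability_setT mule1.
have mY k : measurable_fun setT (Y k).
  by apply/measurable_EFinP; exact: measurable_int (Yint k).
have A_le : \forall w \ae P, forall u, 0 <= u -> u <= t -> A u w <= `|C| * t.
  apply: filterS2 A0 Cdec => w Aw0 Cw u u0 ut.
  have := Cw 0 u (lexx 0) u0; rewrite Aw0 mulr0 subr0 subr_le0 => /le_trans; apply.
  apply: (@le_trans _ _ (`|C| * u)); first by rewrite ler_wpM2r// ler_norm.
  by rewrite ler_wpM2l.
pose Z k w := (Num.max 0 (Y k w))%:E.
have mZ k : measurable_fun setT (Z k).
  by apply/measurable_EFinP; exact: measurable_maxr.
have Z0 k w : (0 <= Z k w)%E by rewrite lee_fin le_max lexx.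
have ZE k : (\int[P]_w Z k w = (K + `|C| * t)%:E)%E.
  rewrite -(YE k); apply: ae_eq_integral => //; first exact/measurable_EFinP.
  apply: filterS A_le => w Aw _; congr (_%:E); apply: max_r.
  have /andP[u0 ut] := stopped_time_itv t0 ((tau_st k).1 w).
  have := Aw _ u0 ut; rewrite /Y /stopped /N.
  by have := sqr_ge0 (M' (fine (mine t%:E (tau k w))) w); lra.
have lim_le : \forall w \ae P, ((M t w ^+ 2)%:E <= limn_einf (Z ^~ w))%E.
  apply: filterS3 A_le (MM' t t0) tau_oo => w Aw MMw tauw.
  have tau_late : \forall k \near \oo, (t%:E <= tau k w)%E.
    by move/cvgeyPge : tauw => /(_ t).
  have -> : limn_einf (Z ^~ w) = (Num.max 0 (N t w + `|C| * t))%:E.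
    apply: (cvg_limn_einf_sup _).1; apply: cvg_near_cst; near=> k; rewrite /Z /Y stopped_late//.
    by near: k.
  rewrite lee_fin le_max; apply/orP; right.
  by rewrite /N -MMw; have := Aw t t0 (lexx t); lra.
have mlim : measurable_fun setT (fun w => limn_einf (Z ^~ w)).
  apply: measurableT_comp => //; apply: measurable_fun_limn_esup => k.
  exact: measurableT_comp.
apply: (@le_trans _ _ (\int[P]_w limn_einf (Z ^~ w))%E).
  apply: ae_ge0_le_integral => //.
  - by move=> w _; rewrite lee_fin sqr_ge0.
  - by apply/measurable_EFinP; apply: measurable_funX; exact: mM.
  - move=> w _; rewrite limn_einf_lim; apply: lime_ge; first exact: is_cvg_einfs.
    by apply: nearW => k; apply: le_ereal_inf_tmp => _ [j _ <-].
  - by apply: filterS lim_le => w + _.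
apply: le_trans (fatou P measurableT mZ (fun k w _ => Z0 k w)) _.
under eq_fun do rewrite ZE.
by rewrite (cvg_limn_einf_sup (cvg_cst _)).1.
Unshelve. all: by end_near.
Qed.

End second_moment.

(** * Laws of independent pairs and of Brownian motion *)

Section independent_pair.
Context {d d1 d2 : measure_display} {Omega : measurableType d}.
Context {T1 : measurableType d1} {T2 : measurableType d2} {R : realType}.
Variables (P : probability Omega R).
Variables (mu : probability T1 R) (nu : probability T2 R).
Variables (X : Omega -> T1) (Y : Omega -> T2).
Hypotheses (mX : measurable_fun setT X) (mY : measurable_fun setT Y).
Hypothesis law : forall C, measurable C ->
  P ((fun w => (X w, Y w)) @^-1` C) = (mu \x nu)%E C.

Let mXY : measurable_fun setT (fun w => (X w, Y w)).
Proof. exact: measurable_fun_pair. Qed.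

Let integral_pair (D : set (T1 * T2)) (G : T1 * T2 -> \bar R) :
  (\int[mu \x nu]_(z in D) G z =
   \int[pushforward P (bundle_mfun mXY)]_(z in D) G z)%E.
Proof. by apply: eq_measure_integral => C mC _; exact/esym/law. Qed.

Let integrable_pair (G : T1 * T2 -> \bar R) : measurable_fun setT G ->
  P.-integrable setT (fun w => G (X w, Y w)) -> (mu \x nu)%E.-integrable setT G.
Proof.
move=> mG /integrableP[_ Goo]; apply/integrableP; split => //.
rewrite integral_pair.
rewrite (ge0_integral_pushforward mXY)//; exact: measurableT_comp.
Qed.

(** Fubini for the joint law of X and Y: integrating out Y computes a conditional
    expectation given X. *)
Lemma integral_independent_pair (G : T1 * T2 -> \bar R) (E : set T1) :
  measurable E -> measurable_fun setT G ->
  P.-integrable setT (fun w => G (X w, Y w)) ->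
  (\int[P]_(w in X @^-1` E) G (X w, Y w) =
   \int[mu]_(x in E) \int[nu]_y G (x, y))%E.
Proof.
move=> mE mG iG.
have mET : measurable (E `*` [set: T2]) by exact: measurableX.
have iG' := integrable_pair mG iG.
transitivity (\int[mu \x nu]_(z in E `*` setT) G z)%E.
  rewrite integral_pair (integral_pushforward mXY)//; last first.
    apply: integrableS iG => //.
    by rewrite -[X in measurable X]setTI; exact: mXY.
  by congr integral; apply/seteqP; split => w //= [].
rewrite [LHS]integral_mkcond.
rewrite -integral12_prod_meas1; last first.
  apply/(integrable_mkcond _ mET); exact: (integrableS measurableT).
rewrite [RHS]integral_mkcond; apply: eq_integral => x _.
rewrite [RHS]patchE; case: ifPn => xE.
  by apply: eq_integral => y _; rewrite patchE ifT// inE; split => //=; rewrite inE in xE.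
apply: integral0_eq => y _; rewrite patchE ifF//.
by apply/negbTE; apply: contra xE; rewrite !inE => -[].
Qed.

(** If h(X) is a version of the conditional expectation of G(X, Y) given X, then h
    is the partial integral of G, almost everywhere for the law of X. *)
Lemma ae_eq_independent_pair (G : T1 * T2 -> \bar R) (h : T1 -> \bar R) :
  measurable_fun setT G -> measurable_fun setT h ->
  P.-integrable setT (fun w => G (X w, Y w)) ->
  P.-integrable setT (fun w => h (X w)) ->
  (forall E, measurable E -> (\int[P]_(w in X @^-1` E) G (X w, Y w) =
                              \int[P]_(w in X @^-1` E) h (X w))%E) ->
  ae_eq mu setT (fun x => \int[nu]_y G (x, y))%E h.
Proof.
move=> mG mh iG ih Gh; apply: integral_ae_eq => //.
  exact: (integrable_fubini_F (integrable_pair mG iG)).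
move=> E _ mE; rewrite -integral_independent_pair// Gh//.
rewrite (@integral_independent_pair (h \o fst))//; last exact: measurableT_comp.
apply: eq_integral => x _ /=; rewrite integral_cst//=.
by rewrite probability_setT mule1.
Qed.

End independent_pair.

Section laws.
Context {R : realType}.

Definition boxes n : set (set (n.-tuple R)) :=
  [set A | exists2 B : 'I_n -> set R, (forall i, measurable (B i)) &
    A = [set x | forall i, B i (tnth x i)]].

Lemma measurable_box n (B : 'I_n -> set R) : (forall i, measurable (B i)) ->
  measurable [set x : n.-tuple R | forall i, B i (tnth x i)].
Proof.
move=> mB.
rewrite (_ : [set _ | _] =
    \bigcap_(i in [set: 'I_n]) ((@tnth _ R ^~ i) @^-1` B i)).
  apply: fin_bigcap_measurable => // i _.
  by rewrite -[X in measurable X]setTI; exact: measurable_tnth.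
by apply/seteqP; split => x /= H i; [move=> _; exact: H|exact: H i I].
Qed.

(** Boxes form a pi-system generating the Borel sets, so that they determine
    finite measures. *)
Lemma measurable_boxes n : @measurable _ (n.-tuple R) = <<s @boxes n >>.
Proof.
apply/seteqP; split; last first.
  apply: smallest_sub; first exact: sigma_algebra_measurable.
  by move=> _ [B mB ->]; exact: measurable_box.
apply: smallest_sub; first exact: smallest_sigma_algebra.
move=> A; rewrite -bigcup_seq => -[i _ [B mB <-]]; apply: sub_sigma_algebra.
exists (fun j => if j == i then B else setT).
  by move=> j; case: ifP.
rewrite setTI; apply/seteqP; split => x /=.
  by move=> Bx j; case: eqP => // ->.
by move=> /(_ i); rewrite eqxx.
Qed.

Lemma eq_measure_boxes n (m1 m2 : {measure set (n.-tuple R) -> \bar R}) :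
  (m1 setT < +oo)%E ->
  (forall B : 'I_n -> set R, (forall i, measurable (B i)) ->
    m1 [set x | forall i, B i (tnth x i)] =
    m2 [set x | forall i, B i (tnth x i)]) ->
  forall A, measurable A -> m1 A = m2 A.
Proof.
move=> m1oo m12.
apply: (measure_unique (@boxes n) (fun=> setT) (measurable_boxes n)) => //.
- move=> _ _ [B mB ->] [C mC ->]; exists (fun i => B i `&` C i).
    by move=> i; exact: measurableI.
  apply/seteqP; split => x /=; first by move=> [Bx Cx] i; split.
  by move=> BCx; split => i; have [] := BCx i.
- by move=> _; exists (fun=> setT) => //; apply/seteqP.
- by rewrite bigcup_const.
- by move=> _ [B mB ->]; exact: m12.
Qed.

End laws.

Section brownian_laws.
Context {d : measure_display} {Omega : measurableType d} {R : realType}.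
Variables (P : probability Omega R) (n : nat) (W : R -> Omega -> n.-tuple R).
Hypothesis hW : standard_brownian_motion P W.

Lemma measurable_increment s t : 0 <= s -> 0 <= t ->
  measurable_fun setT (increment W s t).
Proof.
move=> s0 t0; apply/measurable_fun_tnthP => i.
rewrite (_ : _ \o _ = fun w => tnth (W t w) i - tnth (W s w) i); last first.
  by apply/funext => w /=; rewrite tnth_mktuple.
by apply: measurable_funB;
  apply: (measurableT_comp (measurable_tnth i)); exact: (bm_measurable hW).
Qed.

Lemma increment_law s t (A : set (n.-tuple R)) : 0 <= s -> s < t ->
  measurable A ->
  P (increment W s t @^-1` A) = gauss_prob (Num.sqrt (t - s)) A.
Proof.
move=> s0 st mA.
have t0 : 0 <= t by rewrite (le_trans s0)// ltW.
have mi := measurable_increment s0 t0.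
apply: (@eq_measure_boxes R n (pushforward P (bundle_mfun mi))) => //.
  by rewrite /= /pushforward preimage_setT probability_setT ltry.
move=> B mB.
exact: etrans (bm_gauss hW s0 st mB) (esym (gauss_prob_box _ mB)).
Qed.

Lemma increment0 t : \forall w \ae P, increment W 0 t w = W t w.
Proof.
apply: filterS (bm_start hW) => w W0; apply: eq_from_tnth => i.
by rewrite tnth_mktuple W0 subr0.
Qed.

Lemma brownian_law t (A : set (n.-tuple R)) : 0 < t -> measurable A ->
  P (W t @^-1` A) = gauss_prob (Num.sqrt t) A.
Proof.
move=> t0 mA; rewrite -[in RHS](subr0 t) -increment_law//.
have mW : measurable (W t @^-1` A).
  by rewrite -[X in measurable X]setTI; apply: (bm_measurable hW) => //; exact: ltW.
have mi : measurable (increment W 0 t @^-1` A).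
  by rewrite -[X in measurable X]setTI; apply: measurable_increment => //; exact: ltW.
rewrite -[W t @^-1` A]setIT -integral_indic// -[increment W 0 t @^-1` A]setIT.
rewrite -[RHS]integral_indic//.
apply: ge0_ae_eq_integral => //.
- by apply/measurable_EFinP; exact: measurable_indic.
- by apply/measurable_EFinP; exact: measurable_indic.
apply: filterS (increment0 t) => w iw _; rewrite !indicE; congr ((nat_of_bool _)%:R%:E).
by apply/idP/idP; rewrite !inE/= iw.
Qed.

Lemma ge0_expectation_brownian t (F : n.-tuple R -> \bar R) : 0 < t ->
  measurable_fun setT F -> (forall x, 0 <= F x)%E ->
  (\int[P]_w F (W t w) = \int[gauss_prob (Num.sqrt t)]_x F x)%E.
Proof.
move=> t0 mF F0.
have mW : measurable_fun setT (W t) by apply: (bm_measurable hW) => //; exact: ltW.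
rewrite -[LHS](ge0_integral_pushforward mW P measurableT mF)//.
apply: eq_measure_integral => A mA _.
exact: brownian_law.
Qed.

Lemma brownian_pair_law s t (X : set (n.-tuple R * n.-tuple R)) :
  0 < s -> s < t -> measurable X ->
  P ((fun w => (W s w, increment W s t w)) @^-1` X) =
  (gauss_prob (Num.sqrt s) \x gauss_prob (Num.sqrt (t - s)))%E X.
Proof.
move=> s0 st mX.
have s0' := ltW s0.
have t0 : 0 <= t by rewrite (le_trans s0')// ltW.
have mi := measurable_increment s0' t0.
have mp : measurable_fun setT (fun w => (W s w, increment W s t w)).
  by apply: measurable_fun_pair => //; exact: (bm_measurable hW).
apply/esym.
apply: (@product_measure_unique _ _ _ _ _ (gauss_prob (Num.sqrt s))
  (gauss_prob (Num.sqrt (t - s))) (pushforward P (bundle_mfun mp))) => //.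
move=> A B mA mB.
transitivity (P (W s @^-1` A) * P (increment W s t @^-1` B))%E; last first.
  by congr (_ * _)%E; [exact: brownian_law|exact: increment_law].
apply: etrans (bm_indep hW s0' st _ mB) => //.
by apply: sub_sigma_algebra; exists s, A; split.
Qed.

(** The martingale property between the times 1 and t = 1 + s^2, where
    W_t = W_1 + (W_t - W_1) is a sum of independent terms.  The law of W_1
    has the same null sets as Lebesgue measure, whence the conclusion for
    Lebesgue almost every x. *)
Lemma ae_harmonic (g : n.-tuple R -> R) (s : R) : 0 < s ->
  measurable_fun setT g ->
  martingale P (brownian_filtration P W) (fun t w => g (W t w)) ->
  \forall x \ae lebesgue_tuple n,
    ((g x)%:E = \int[gauss_prob s]_y (g (translate x y))%:E)%E.
Proof.
move=> s0 mg mart.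
pose t : R := 1 + s ^+ 2.
have lt1t : 1 < t by rewrite ltrDl exprn_gt0.
have le0t : 0 <= t by rewrite ltW// (lt_trans ltr01).
have st1 : Num.sqrt (t - 1) = s.
  by rewrite /t addrC addKr sqrtr_sqr gtr0_norm.
pose F (z : n.-tuple R * n.-tuple R) := (g (translate z.1 z.2))%:E.
have FW w : F (W 1 w, increment W 1 t w) = (g (W t w))%:E.
  congr (g _)%:E; apply: eq_from_tnth => i.
  by rewrite !tnth_mktuple addrC subrK.
have mtr : measurable_fun setT
    (fun z : n.-tuple R * n.-tuple R => translate z.1 z.2).
  apply/measurable_fun_tnthP => i.
  rewrite (_ : _ \o _ = fun z => tnth z.1 i + tnth z.2 i); last first.
    by apply/funext => z /=; rewrite tnth_mktuple.
  by apply: measurable_funD; apply: (measurableT_comp (measurable_tnth i)).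
have mF : measurable_fun setT F.
  by apply/measurable_EFinP; exact: measurableT_comp mtr.
have mW1 : measurable_fun setT (W 1) by exact: (bm_measurable hW).
have iF : P.-integrable setT (fun w => F (W 1 w, increment W 1 t w)).
  rewrite (_ : (fun _ => _) = EFin \o (fun w => g (W t w))).
    exact: (martingale_integrable mart).
  by apply/funext => w; rewrite FW.
have ig : P.-integrable setT (fun w => (g (W 1 w))%:E).
  exact: (martingale_integrable mart).
have law C : measurable C -> P ((fun w => (W 1 w, increment W 1 t w)) @^-1` C) =
    (@gauss_prob R n 1 \x @gauss_prob R n s)%E C.
  have := @brownian_pair_law 1 t C ltr01 lt1t.
  by rewrite st1 sqrtr1.
have := @ae_eq_independent_pair _ _ _ _ _ _ _ P (@gauss_prob R n 1)
  (@gauss_prob R n s) (W 1) (increment W 1 t) mW1 (measurable_increment ler01 le0t)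
  law F (EFin \o g) mF _ iF ig.
case.
- exact/measurable_EFinP.
- move=> E mE.
  rewrite -(martingale_eq mart ler01 (ltW lt1t)).
    by apply: eq_integral => w _; rewrite FW.
  by apply: sub_sigma_algebra; left; exists 1, E.
move=> N [mN N0 sN]; exists N; split => //.
  exact: (dominates_gauss_prob (oner_neq0 _) mN N0).
by move=> x /= Nx; apply: sN => /= /(_ I) gx; apply: Nx; rewrite -gx.
Qed.

End brownian_laws.

(** * Brownian martingales of the form g(W) *)

(** It suffices to use the integers s = k + 1, at the times s^2 at which W has the
    law of sZ: this keeps the exceptional set a countable union of null sets. *)
Lemma ae_affine_brownian_martingale (R : realType) (d : measure_display)
    (Omega : measurableType d) (P : probability Omega R) (n : nat)
    (W : R -> Omega -> n.-tuple R) (g : n.-tuple R -> R) (C : R)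
    (A : R -> Omega -> R) :
  standard_brownian_motion P W -> measurable_fun setT g ->
  martingale P (brownian_filtration P W) (fun t w => g (W t w)) ->
  square_characteristic P (brownian_filtration P W) (fun t w => g (W t w)) A ->
  nonincreasing_process P (fun t w => A t w - C * t) ->
  exists (a : 'I_n -> R) (b : R),
    \forall x \ae lebesgue_tuple n, g x = \sum_i a i * tnth x i + b.
Proof.
move=> hW mg mart [M' modM pqv] Cdec.
have F0T : brownian_filtration P W 0 setT.
  by apply: sub_sigma_algebra; left; exists 0, setT; rewrite preimage_setT.
have mgW t : 0 <= t -> measurable_fun setT (fun w => g (W t w)).
  by move=> t0; apply: measurableT_comp => //; exact: (bm_measurable hW).
have [K bound] := second_moment_le F0T mgW modM pqv Cdec.
apply: (@ae_affine _ _ g (`|K| + `|C|)) => //.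
- move=> k; set s : R := k.+1%:R.
  have s1 : 1 <= s by rewrite /s ler1n.
  have s0 : 0 < s by lra.
  have ss : Num.sqrt (s ^+ 2) = s by rewrite sqrtr_sqr gtr0_norm.
  rewrite -[in X in (X <= _)%E]ss.
  rewrite -(@ge0_expectation_brownian _ _ _ P _ W hW _
      (fun y => (g y ^+ 2)%:E)) ?exprn_gt0//.
  + apply: le_trans (bound _ (sqr_ge0 s)) _.
    rewrite lee_fin mulrDl lerD2r (le_trans (ler_norm K))// ler_peMr//.
    by rewrite expr_ge1//; lra.
  + exact: measurable_square.
  + by move=> y; rewrite lee_fin sqr_ge0.
- apply: ae_foralln => k; apply: (ae_harmonic hW _ mg mart).
  by rewrite ltr0n.
Qed.

Theorem theorem1 (R : realType) (d : measure_display) (Omega : measurableType d)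
    (P : probability Omega R) (n m : nat)
    (W : R -> Omega -> n.-tuple R) (f : n.-tuple R -> m.-tuple R)
    (hW : standard_brownian_motion P W)
    (mf : measurable_fun setT f)
    (hM : vector_martingale P (brownian_filtration P W)
            (fun t w => f (W t w)))
    (hC : forall j : 'I_m, exists (C : R) (A : R -> Omega -> R),
        square_characteristic P (brownian_filtration P W)
          (fun t w => tnth (f (W t w)) j) A /\
        nonincreasing_process P (fun t w => A t w - C * t)) :
  exists (A : 'M[R]_(m, n)) (B : 'cV[R]_m),
    \forall x \ae lebesgue_tuple n,
      \col_j tnth (f x) j = A *m (\col_i tnth x i) + B.
Proof.
have /choice[a /choice[b abP]] : forall j : 'I_m,
    exists (a : 'I_n -> R) (b : R), \forall x \ae lebesgue_tuple n,
      tnth (f x) j = \sum_i a i * tnth x i + b.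
  move=> j; have [C [A [sqA Cdec]]] := hC j.
  apply: (ae_affine_brownian_martingale hW _ (hM j) sqA Cdec).
  exact: measurableT_comp (measurable_tnth j) mf.
exists (\matrix_(j, i) a j i), (\col_j b j).
have : \forall x \ae lebesgue_tuple n, forall j : 'I_m,
    tnth (f x) j = \sum_i a j i * tnth x i + b j.
  exact: filter_forall.
apply: filterS => x fx; apply/colP => j; rewrite !mxE fx; congr (_ + _).
by apply: eq_bigr => i _; rewrite !mxE.
Qed.
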